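(* Let $d\in\mathbb{N}$, let $\boldsymbol{\Theta}=(\Theta_{\boldsymbol{i}})_{\boldsymbol{i}\in\mathbb{Z}^d}$ be a random element of $\mathbb{R}^{\mathbb{Z}^d}$ such that $|\Theta_{\boldsymbol{0}}|=1$ a.s., let $Y$ be a $\mathrm{Pareto}(\alpha)$-distributed random variable for some $\alpha>0$, and assume that $\boldsymbol{\Theta}$ and $Y$ are independent. Then $$\mathbb{E}\left[h\left(|\Theta_{\boldsymbol{k}}|^{-1}\varphi_{\boldsymbol{k}}\boldsymbol{\Theta}\right)\mathbf{1}\{\Theta_{\boldsymbol{k}}\neq0\}\right]=\mathbb{E}\left[h(\boldsymbol{\Theta})|\Theta_{-\boldsymbol{k}}|^{\alpha}\right]$$ holds for all measurable $h:\mathbb{R}^{\mathbb{Z}^d}\to[0,\infty)$ and all $\boldsymbol{k}\in\mathbb{Z}^d$ if and only if $\boldsymbol{Y}:=Y\cdot\boldsymbol{\Theta}$ is exceedance-stationary.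
   Context: $\mathrm{Pareto}(\alpha)$ means $\mathbb{P}(Y>y)=y^{-\alpha}$ for $y\ge1$. $\mathbb{R}^{\mathbb{Z}^d}$ carries the product $\sigma$-algebra and $\mathbb{R}^{\mathbb{Z}^d}_0=\{\boldsymbol{x}\in\mathbb{R}^{\mathbb{Z}^d}:|x_{\boldsymbol{0}}|>1\}$. For $\boldsymbol{k}\in\mathbb{Z}^d$ the shift is $\varphi_{\boldsymbol{k}}\boldsymbol{x}=(x_{\boldsymbol{i}+\boldsymbol{k}})_{\boldsymbol{i}\in\mathbb{Z}^d}$. The set of exceedance-points of $\boldsymbol{x}$ is $\mathrm{e}(\boldsymbol{x})=\{\boldsymbol{k}\in\mathbb{Z}^d:|x_{\boldsymbol{k}}|>1\}$. Exceedance-maps: let $B\subseteq\mathbb{R}^{\mathbb{Z}^d}_0$ be a Borel set such that $\boldsymbol{x}\in B$ and $\boldsymbol{k}\in\mathrm{e}(\boldsymbol{x})$ imply $\varphi_{\boldsymbol{k}}\boldsymbol{x}\in B$. A measurable map $\tau:B\to\mathbb{Z}^d$ is an exceedance-map on $B$ if $\tau(\boldsymbol{x})\in\mathrm{e}(\boldsymbol{x})$ for all $\boldsymbol{x}\in B$. It is bijective on $B$ if, for every $\boldsymbol{x}\in B$, the map $\boldsymbol{k}\mapsto\boldsymbol{k}+\tau(\varphi_{\boldsymbol{k}}\boldsymbol{x})$ is a bijection of $\mathrm{e}(\boldsymbol{x})$ onto itself. The associated exceedance-shift is $\varphi_\tau\boldsymbol{x}:=\varphi_{\tau(\boldsymbol{x})}\boldsymbol{x}$.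 For a random element $\boldsymbol{Y}$ of $\mathbb{R}^{\mathbb{Z}^d}_0$, an exceedance-map is $\boldsymbol{Y}$-bijective if it is bijective on some Borel set $B\subseteq\mathbb{R}^{\mathbb{Z}^d}_0$ such that $\boldsymbol{x}\in B$ and $\boldsymbol{k}\in\mathrm{e}(\boldsymbol{x})$ imply $\varphi_{\boldsymbol{k}}\boldsymbol{x}\in B$, and such that $\mathbb{P}(\boldsymbol{Y}\in B)=1$. A random element $\boldsymbol{Y}$ of $\mathbb{R}^{\mathbb{Z}^d}_0$ is exceedance-stationary if $\varphi_\tau\boldsymbol{Y}$ and $\boldsymbol{Y}$ have the same distribution for every $\boldsymbol{Y}$-bijective exceedance-map $\tau$. *)

(* Defs.v *)
From HB Require Import structures.
From mathcomp Require Import all_boot all_order all_algebra.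
From mathcomp Require Import all_classical all_reals all_analysis.
From mathcomp Require Import measurable_realfun.

Set Implicit Arguments.
Unset Strict Implicit.
Unset Printing Implicit Defensive.

Import Order.TTheory GRing.Theory Num.Theory.
Import numFieldNormedType.Exports.

Local Open Scope classical_set_scope.
Local Open Scope ring_scope.

HB.instance Definition _ := isPointed.Build int 0.
HB.instance Definition _ (d : nat) :=
  @isMeasurable.Build default_measure_display 'rV[int]_d discrete_measurable
    discrete_measurable0 discrete_measurableC discrete_measurableU.

(* The space R^(Z^d), with Z^d represented by the integer row vectors. *)
Definition lattice_field (R : realType) (d : nat) : Type := 'rV[int]_d -> R.

Definition cylinders (R : realType) (d : nat) :
    set_system (lattice_field R d) :=
  \bigcup_(i in [set: 'rV[int]_d])
    preimage_set_system [set: lattice_field R d] (fun x => x i) measurable.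

Definition field_display : measure_display.
Proof. by constructor. Qed.

Section product_sigma_algebra.
Variables (R : realType) (d : nat).

HB.instance Definition _ :=
  Pointed.copy (lattice_field R d) (forall _ : 'rV[int]_d, R).

Let field_measurable0 : <<s @cylinders R d >> set0.
Proof. exact: sigma_algebra0. Qed.

Let field_measurableC (A : set (lattice_field R d)) :
  <<s @cylinders R d >> A -> <<s @cylinders R d >> (~` A).
Proof. exact: sigma_algebraC. Qed.

Let field_measurable_bigcup (F : (set (lattice_field R d))^nat) :
  (forall i, <<s @cylinders R d >> (F i)) ->
  <<s @cylinders R d >> (\bigcup_i F i).
Proof. exact: sigma_algebra_bigcup. Qed.

HB.instance Definition _ := @isMeasurable.Build field_display
  (lattice_field R d) <<s @cylinders R d >> field_measurable0 field_measurableC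
  field_measurable_bigcup.

Lemma measurable_coord (i : 'rV[int]_d) :
  measurable_fun [set: lattice_field R d] (fun x : lattice_field R d => x i).
Proof.
move=> _ A mA; apply: sub_sigma_algebra.
by exists i => //; exists A.
Qed.

Lemma measurable_fun_field d' (T : measurableType d')
    (f : T -> lattice_field R d) :
  (forall i, measurable_fun [set: T] (fun w => f w i)) ->
  measurable_fun [set: T] f.
Proof.
move=> mf; apply: (@measurability _ _ _ _ _ f (@cylinders R d)) => //.
move=> _ [_ [i _ [A mA <-]] <-].
rewrite (_ : _ `&` _ = setT `&` (fun w => f w i) @^-1` A); first exact: mf.
by apply/seteqP; split=> w /= [].
Qed.

End product_sigma_algebra.

Section field_operations.
Variables (R : realType) (d : nat).
Implicit Types (x : lattice_field R d) (k : 'rV[int]_d).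

Definition shift_field k x : lattice_field R d := fun i => x (i + k).

Definition scale_field (c : R) x : lattice_field R d := fun i => c * x i.

Definition field0 : set (lattice_field R d) := [set x | 1 < `|x 0|].

Definition exceedances x : set 'rV[int]_d := [set k | 1 < `|x k|].

End field_operations.

Section exceedance_maps.
Variables (R : realType) (d : nat).
Implicit Types (B : set (lattice_field R d))
  (tau : lattice_field R d -> 'rV[int]_d).

Definition exceedance_domain B : Prop :=
  [/\ measurable B, B `<=` @field0 R d &
      forall x k, B x -> exceedances x k -> B (shift_field k x)].

(* A map defined on B is represented by a total function, the values of which
   outside of B are never used. *)
Definition exceedance_map B tau : Prop :=
  measurable_fun B tau /\ forall x, B x -> exceedances x (tau x).

Definition bijective_on B tau : Prop :=
  forall x, B x -> set_bij (exceedances x) (exceedances x)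
                     (fun k => k + tau (shift_field k x)).

Definition exceedance_shift tau (x : lattice_field R d) : lattice_field R d :=
  shift_field (tau x) x.

End exceedance_maps.

Section random_fields.
Context d' (T : measurableType d') (R : realType) (P : probability T R).
Variable d : nat.

(* [tau] is X-bijective, with B as a witnessing set. *)
Definition bijective_exceedance_map (X : {RV P >-> lattice_field R d})
    (B : set (lattice_field R d))
    (tau : lattice_field R d -> 'rV[int]_d) : Prop :=
  [/\ exceedance_domain B, exceedance_map B tau, bijective_on B tau &
      distribution P X B = 1%E].

(* Random elements of [field0] are random fields lying in it almost surely.
   As [exceedance_shift tau] is only meaningful on the almost sure event that X
   is in B, the law of the shifted field is evaluated on that event. *)
Definition exceedance_stationary (X : {RV P >-> lattice_field R d}) : Prop :=
  {ae P, forall w, field0 (X w)} /\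
  forall B tau, bijective_exceedance_map X B tau ->
  forall A, measurable A ->
    distribution P X (B `&` exceedance_shift tau @^-1` A) = distribution P X A.

Definition pareto (alpha : R) (Y : {RV P >-> R}) : Prop :=
  forall y, 1 <= y -> ccdf Y y = (y `^ (- alpha))%:E.

Definition independent_RV d1 d2 (T1 : measurableType d1)
    (T2 : measurableType d2) (X1 : {RV P >-> T1}) (X2 : {RV P >-> T2}) : Prop :=
  forall A1 A2, measurable A1 -> measurable A2 ->
  P (X1 @^-1` A1 `&` X2 @^-1` A2) = (P (X1 @^-1` A1) * P (X2 @^-1` A2))%E.

Definition scale_RV (Y : {RV P >-> R})
    (Theta : {RV P >-> lattice_field R d}) :
  T -> lattice_field R d := fun w => scale_field (Y w) (Theta w).

Lemma measurable_scale_RV (Y : {RV P >-> R})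
    (Theta : {RV P >-> lattice_field R d}) :
  measurable_fun [set: T] (scale_RV Y Theta).
Proof.
apply: measurable_fun_field => i; apply: measurable_funM => //.
exact: (measurableT_comp (measurable_coord i)).
Qed.

HB.instance Definition _ (Y : {RV P >-> R})
    (Theta : {RV P >-> lattice_field R d}) :=
  isMeasurableFun.Build _ _ _ _ (scale_RV Y Theta)
    (measurable_scale_RV Y Theta).

End random_fields.

Arguments bijective_exceedance_map {d' T R} P {d} X B tau.
Arguments exceedance_stationary {d' T R} P {d} X.
Arguments pareto {d' T R} P alpha Y.
Arguments independent_RV {d' T R} P {d1 d2 T1 T2} X1 X2.

(* Main.v *)
Require Import Defs.
From HB Require Import structures.
From mathcomp Require Import all_boot all_order all_algebra.
From mathcomp Require Import all_classical all_reals all_analysis.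
From mathcomp Require Import measurable_realfun.

Set Implicit Arguments.
Unset Strict Implicit.
Unset Printing Implicit Defensive.

Import Order.TTheory GRing.Theory Num.Theory.
Import numFieldNormedType.Exports.

Local Open Scope classical_set_scope.
Local Open Scope ring_scope.

(** Write X = Y * Theta and let Q be its law. Both sides of the equivalence are
shown to be equivalent to a third property of Q, the exchange formula
[exchange_formula]: for every lattice point k,
  Q(|x_k| > 1, phi_k x in A) = Q(|x_(-k)| > 1, x in A)   for all A.
It says that moving the origin from one exceedance-point to another does not
favour any configuration.

Exchange formula and exceedance-stationarity. If tau is bijective on B, split
the event that phi_tau X lies in A according to the value k of tau and apply
the exchange formula to each piece. The pieces become the events that X lies
in A and that the exceedance-point -k is sent to the origin by
j |-> j + tau(phi_j X). As this map is a bijection of the exceedance-points,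
exactly one of these events occurs when X lies in both A and B, and the pieces
add up to Q(A) ([stationary_of_exchange]).
Conversely, fix k and a measurable set S such that x in S excludes
phi_k x in S. Exchanging the roles of x and phi_k x whenever phi_k x lies in S
(and both 0 and k are exceedance-points) is an involution, hence a bijective
exceedance-map ([swap_map]); stationarity under it is the exchange formula for
the subsets of S ([exchange_separated]). If phi_k x differs from x, then some
rational level is crossed between two coordinates of x that are k apart, so
countably many such sets S cover all fields except the k-periodic ones
([crossing_cover]). On k-periodic fields the exchange formula is trivial.

Exchange formula and time change formula. The Pareto law has the scaling
property ([pareto_scale])
  c^alpha P(Y/c in U, Y/c > 1) = P(Y in U, cY > 1),   c > 0.
Let Theta' = |Theta_k|^(-1) phi_k Theta, so that |Theta'_(-k)| = 1/|Theta_k|.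
Then phi_k X = (Y/c) Theta' with c = |Theta'_(-k)|: integrating Y out, the left
side of the exchange formula is the expectation of h(Theta') on Theta_k <> 0,
where h(theta) = P((Y/c) theta in A, Y/c > 1) and c = |theta_(-k)|. The time
change formula turns it into the expectation of h(Theta) c^alpha with
c = |Theta_(-k)|, which is the right side by scaling
([exchange_of_time_change]).
Conversely, apply the exchange formula to the function
x |-> (h W)(x / |x_0|) with the weight W(theta) = max(1, |theta_(-k)|)^alpha,
chosen so that W(Theta') is the inverse of the conditional probability of
|X_k| > 1 given Theta where Theta_k <> 0 ([time_change_of_exchange]). *)

(** * Measure-theoretic preliminaries *)

Lemma measurable_preimage d1 d2 (T1 : measurableType d1)
    (T2 : measurableType d2) (f : T1 -> T2) (A : set T2) :
  measurable_fun [set: T1] f -> measurable A -> measurable (f @^-1` A).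
Proof. by move=> mf mA; rewrite -[X in measurable X]setTI; exact: mf. Qed.

Lemma measurable_mem d' (T : measurableType d') (A : set T) :
  measurable A -> measurable_fun [set: T] (fun x => x \in A).
Proof.
move=> mA; apply: (measurable_fun_bool true); rewrite setTI.
rewrite (_ : _ @^-1` _ = A) //; apply/seteqP.
by split=> x /=; [move=> /set_mem|move=> ?; rewrite mem_set].
Qed.

Lemma measurable_gt1 d (T : measurableType d) (R : realType) (f : T -> R) :
  measurable_fun [set: T] f -> measurable [set x | 1 < `|f x|].
Proof.
move=> mf; rewrite (_ : [set _ | _] = (fun x => `|f x|) @^-1` `]1, +oo[).
  by apply: measurable_preimage => //; exact: measurableT_comp.
by apply/seteqP; split=> x /=; rewrite in_itv /= andbT.
Qed.

Lemma measurable_gt1_preimage d1 d2 (T1 : measurableType d1)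
    (T2 : measurableType d2) (R : realType) (u : T1 -> R) (v : T1 -> T2)
    (A : set T2) :
  measurable_fun [set: T1] u -> measurable_fun [set: T1] v -> measurable A ->
  measurable [set z | 1 < `|u z| /\ A (v z)].
Proof.
move=> mu mv mA; apply: measurableI; first exact: measurable_gt1.
exact: measurable_preimage.
Qed.

Lemma measurable_invr_ge0 d (T : measurableType d) (R : realType) (f : T -> R) :
  (forall x, 0 <= f x) -> measurable_fun [set: T] f ->
  measurable_fun [set: T] (fun x => (f x)^-1).
Proof.
move=> f0 mf; rewrite (_ : (fun _ => _) = (fun x => f x `^ (-1))).
  exact: (measurableT_comp (measurable_powR _)).
by apply/funext => x; rewrite powR_inv1.
Qed.

Lemma probability_full_setI d (T : measurableType d) (R : realType)
    (P : probability T R) (B C : set T) :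
  measurable B -> P B = 1%E -> measurable C -> P (B `&` C) = P C.
Proof.
move=> mB PB mC; rewrite [RHS](measureDI P mC mB) setIC.
rewrite -[LHS]add0e; congr (_ + _)%E; apply/esym/eqP.
rewrite eq_le measure_ge0 andbT.
apply: (@le_trans _ _ (P (~` B))).
  by apply: le_measure; rewrite ?inE; [exact: measurableD|exact: measurableC|
     exact: subIsetr].
by rewrite probability_setC // PB subee.
Qed.

(** The image under f of the restriction of m to D, bundled as a measure. *)
Definition restricted_image d (T : measurableType d) (R : realType)
    (m : measure T R) (D : set T) (mD : measurable D) d'
    (T' : measurableType d') (f : T -> T')
    (mf : measurable_fun [set: T] f) : measure T' R.
Proof. refine (pushforward (mrestr m mD) f); exact: mf. Defined.

Lemma integral_mrestr d (T : measurableType d) (R : realType)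
    (m : measure T R) (D : set T) (mD : measurable D) (f : T -> \bar R) :
  measurable_fun [set: T] f -> (forall x, (0 <= f x)%E) ->
  (\int[mrestr m mD]_x f x = \int[m]_(x in D) f x)%E.
Proof.
move=> mf f0.
rewrite (@ge0_negligible_integral _ _ _ (mrestr m mD) setT (~` D)) //.
- rewrite setDE setCK setTI; apply: eq_measure_integral => A mA AD.
  by rewrite /= /mrestr setIidl.
- exact: measurableC.
- by rewrite /= /mrestr setICl measure0.
Qed.

Lemma measurable_section d1 d2 (T1 : measurableType d1) (T2 : measurableType d2)
    (R : realType) (m : probability T2 R) (D : set (T1 * T2)) :
  measurable D -> measurable_fun [set: T1] (fun x => m [set y | D (x, y)]).
Proof.
move=> mD; rewrite (_ : (fun _ => _) = m \o xsection D).
  exact: measurable_fun_xsection.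
apply/funext => x /=; congr (m _).
apply/seteqP; split=> y /=; rewrite /xsection /= => ?; first by rewrite inE.
exact/set_mem.
Qed.

(** * Shifts *)

Section shifts.
Variables (R : realType) (d : nat).
Implicit Types (x : lattice_field R d) (k l : 'rV[int]_d).

Lemma shift_field0 x : shift_field 0 x = x.
Proof. by apply/funext => i; rewrite /shift_field addr0. Qed.

Lemma shift_fieldD k l x :
  shift_field k (shift_field l x) = shift_field (k + l) x.
Proof. by apply/funext => i; rewrite /shift_field addrA. Qed.

Lemma shift_fieldK k : cancel (@shift_field R d k) (shift_field (- k)).
Proof. by move=> x; rewrite shift_fieldD addNr shift_field0. Qed.

Lemma shift_fieldNK k : cancel (@shift_field R d (- k)) (shift_field k).
Proof. by move=> x; rewrite shift_fieldD addrN shift_field0. Qed.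

Lemma shift_field_fixed k x i : shift_field k x = x -> x (i + k) = x i.
Proof. by move=> per; rewrite -[in RHS]per. Qed.

Lemma measurable_shift k :
  measurable_fun [set: lattice_field R d] (@shift_field R d k).
Proof. by apply: measurable_fun_field => i; exact: measurable_coord. Qed.

Lemma measurable_exceed k :
  measurable [set x : lattice_field R d | 1 < `|x k|].
Proof. exact: measurable_gt1 (measurable_coord k). Qed.

Lemma exceedance_domain_field0 : exceedance_domain (@field0 R d).
Proof.
split=> //; first exact: measurable_exceed.
by move=> x k _; rewrite /exceedances /field0 /shift_field /= add0r.
Qed.

End shifts.

(** * The exchange formula *)

(** Among the fields with an exceedance at the origin, the shift by k is a
bijection from those with an exceedance at k onto those with an exceedance at
-k, the former origin. For Q carried by such fields, the formula says that this
bijection preserves Q. *)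
Definition exchange_formula (R : realType) (d : nat)
    (Q : set (lattice_field R d) -> \bar R) : Prop :=
  forall k A, measurable A ->
    Q [set x | 1 < `|x k| /\ A (shift_field k x)]
    = Q [set x | 1 < `|x (- k)| /\ A x].

(** The two sides of the exchange formula, as measures in the set A. *)
Section exchange_measures.
Variables (R : realType) (d : nat) (Q : probability (lattice_field R d) R).
Variable k : 'rV[int]_d.

Definition departure : measure (lattice_field R d) R :=
  restricted_image Q (measurable_exceed (R := R) k)
    (measurable_shift (R := R) k).

Definition arrival : measure (lattice_field R d) R :=
  mrestr Q (measurable_exceed (R := R) (- k)).

Lemma departureE A :
  departure A = Q [set x | 1 < `|x k| /\ A (shift_field k x)].
Proof. by rewrite /departure /= /pushforward /mrestr setIC. Qed.

Lemma arrivalE A : arrival A = Q [set x | 1 < `|x (- k)| /\ A x].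
Proof. by rewrite /arrival /= /mrestr setIC. Qed.

End exchange_measures.

Lemma exchange_integral (R : realType) (d : nat)
    (Q : probability (lattice_field R d) R) (k : 'rV[int]_d)
    (g : lattice_field R d -> \bar R) :
  exchange_formula Q -> measurable_fun [set: lattice_field R d] g ->
  (forall x, (0 <= g x)%E) ->
  (\int[Q]_(x in [set x | (1 < `|x k|)%R]) g (shift_field k x)
   = \int[Q]_(x in [set x | (1 < `|x (- k)|)%R]) g x)%E.
Proof.
move=> exQ mg g0.
have mgk : measurable_fun [set: lattice_field R d] (g \o shift_field k).
  by apply: measurableT_comp => //; exact: measurable_shift.
rewrite -(integral_mrestr _ (measurable_exceed k)) //.
rewrite -(integral_mrestr _ (measurable_exceed (- k))) //.
transitivity (\int[departure Q k]_x g x)%E.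
  by rewrite ge0_integral_pushforward //; exact: measurable_shift.
apply: eq_measure_integral => A mA _.
by rewrite departureE exQ // -arrivalE.
Qed.

(** * Exceedance-stationarity and the exchange formula *)

Section stationarity_of_exchange.
Variables (R : realType) (d : nat) (Q : probability (lattice_field R d) R).

(** Mass transport: a field of A in B receives its mass from exactly one of its
exceedance-points, because tau permutes them. *)
Lemma stationary_of_exchange (B : set (lattice_field R d))
    (tau : lattice_field R d -> 'rV[int]_d) (A : set (lattice_field R d)) :
  exchange_formula Q ->
  exceedance_domain B -> exceedance_map B tau -> Defs.bijective_on B tau ->
  Q B = 1%E -> measurable A ->
  Q (B `&` exceedance_shift tau @^-1` A) = Q A.
Proof.
move=> exQ [mB B0 Bshift] [mtau etau] btau QB mA.
have mBtau k : measurable (B `&` tau @^-1` [set k]) by exact: mtau.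
pose S k := shift_field (- k) @^-1` (B `&` tau @^-1` [set k]) `&` A.
have mS k : measurable (S k).
  apply: measurableI => //; apply: measurable_preimage => //.
  exact: measurable_shift.
(* F n collects the fields displaced by the lattice point of code n into A, and
   G n the fields of A to which that displacement leads; a number that codes no
   lattice point gives empty events. *)
pose F n := [set x | B x /\ A (shift_field (tau x) x) /\ pickle (tau x) = n].
pose G n := [set x | B x /\ A x /\ exists k, [/\ pickle k = n, 1 < `|x (- k)| &
  tau (shift_field (- k) x) = k]].
have FE k : F (pickle k) = [set x | 1 < `|x k| /\ S k (shift_field k x)].
  apply/seteqP; split => x /=.
    move=> [Bx [Ax /(pcan_inj pickleK) tk]]; rewrite /S /= shift_fieldK.
    by rewrite -tk; split => //; exact: etau.
  by rewrite /S /= shift_fieldK => -[xk [[Bx tk]]]; rewrite /F /= tk.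
have GE k : G (pickle k) = B `&` [set x | 1 < `|x (- k)| /\ S k x].
  apply/seteqP; split => x /=.
    move=> [Bx [Ax [l [/(pcan_inj pickleK) -> xk tk]]]].
    by split=> //; split => //; split => //; split => //; exact: Bshift.
  by move=> [Bx [xk [[B'x tk] Ax]]]; split=> //; split=> //; exists k.
have mset k (l : 'rV[int]_d) :
    measurable [set x : lattice_field R d |
      1 < `|x l| /\ S k (shift_field k x)].
  apply: measurable_gt1_preimage => //; first exact: measurable_coord.
  exact: measurable_shift.
have mset' k (l : 'rV[int]_d) :
    measurable [set x : lattice_field R d | 1 < `|x l| /\ S k x].
  by apply: measurableI => //; exact: measurable_exceed.
have [F0 G0] : (forall n, ~ (exists k : 'rV[int]_d, pickle k = n) -> F n = set0)
    /\ (forall n, ~ (exists k : 'rV[int]_d, pickle k = n) -> G n = set0).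
  split=> n Nn; apply/seteqP; split=> // x [_ [_]].
    by move=> kn; apply: Nn; exists (tau x).
  by move=> [k [kn _ _]]; apply: Nn; exists k.
have FG n : Q (F n) = Q (G n).
  have [[k <-]|Nn] := pselect (exists k : 'rV[int]_d, pickle k = n).
    by rewrite FE GE exQ // (probability_full_setI mB QB).
  by rewrite F0 // G0.
have mF n : measurable (F n).
  have [[k <-]|Nn] := pselect (exists k : 'rV[int]_d, pickle k = n).
    by rewrite FE.
  by rewrite F0.
have mG n : measurable (G n).
  have [[k <-]|Nn] := pselect (exists k : 'rV[int]_d, pickle k = n).
    by rewrite GE; exact: measurableI.
  by rewrite G0.
have FU : B `&` exceedance_shift tau @^-1` A = \bigcup_n F n.
  apply/seteqP; split=> [x [Bx Ax]|x [n _ [Bx [Ax _]]]]; last by split.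
  by exists (pickle (tau x)).
have arrival0 x k : 1 < `|x (- k)| -> tau (shift_field (- k) x) = k ->
    exceedances x (- k) /\ - k + tau (shift_field (- k) x) = 0.
  by move=> xk ->; split => //; rewrite addNr.
have GU : B `&` A = \bigcup_n G n.
  apply/seteqP; split=> [x [Bx Ax]|x [n _ [Bx [Ax _]]]]; last by split.
  have [_ _ /(_ 0 (B0 _ Bx))[j ej j0]] := btau _ Bx.
  have tj : tau (shift_field j x) = - j.
    by apply/eqP; rewrite -addr_eq0 addrC j0.
  exists (pickle (- j)) => //; split => //; split => //.
  by exists (- j); rewrite opprK; split.
have tF : trivIset setT F.
  apply/trivIsetP => m n _ _; apply: contraNeq => /set0P[x].
  by move=> [[_ [_ <-]] [_ [_ <-]]].
have tG : trivIset setT G.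
  apply/trivIsetP => m n _ _; apply: contraNeq => /set0P[x].
  move=> [[Bx [_ [k [<- ek tk]]]] [_ [_ [l [<- el tl]]]]].
  have [k1 k2] := arrival0 _ _ ek tk.
  have [l1 l2] := arrival0 _ _ el tl.
  have [_ inj _] := btau _ Bx.
  have /oppr_inj -> // : - k = - l.
  by apply: inj; rewrite ?inE // k2 l2.
rewrite -[RHS](probability_full_setI mB QB) // FU GU !measure_bigcup //.
by apply: eq_eseriesr => n _; exact: FG.
Qed.

End stationarity_of_exchange.

Section swap.
Variables (R : realType) (d : nat).
Implicit Types (x : lattice_field R d) (k : 'rV[int]_d).

(** Exchanges x with phi_k x whenever phi_k x lies in S. This is consistent
when S is disjoint from its shift by k: then a field cannot be asked to move
both by k and by -k. *)
Definition swap_map k (S : set (lattice_field R d)) x : 'rV[int]_d :=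
  if (1 < `|x k|) && (shift_field k x \in S) then k
  else if (1 < `|x (- k)|) && (x \in S) then - k else 0.

(** The hypothesis says that j |-> j + tau(phi_j x) is an involution. *)
Lemma bijective_on_involutive (B : set (lattice_field R d)) tau :
  exceedance_domain B -> exceedance_map B tau ->
  (forall x, B x -> tau (shift_field (tau x) x) = - tau x) ->
  Defs.bijective_on B tau.
Proof.
move=> [_ B0 Bshift] [_ etau] invol x Bx.
set f := (X in set_bij _ _ X).
have f_exc k : exceedances x k -> exceedances x (f k).
  move=> xk; have := etau _ (Bshift _ _ Bx xk).
  by rewrite /exceedances /= /shift_field /f addrC.
have fK k : exceedances x k -> f (f k) = k.
  move=> xk; have := invol _ (Bshift _ _ Bx xk).
  by rewrite shift_fieldD [X in shift_field X]addrC /f => ->; rewrite addrK.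
split=> //.
- by move=> k l; rewrite !inE => xk xl fkl; rewrite -[k]fK // fkl fK.
- by move=> k xk; exists (f k); [exact: f_exc|exact: fK].
Qed.

Lemma measurable_swap_map k S :
  measurable S -> measurable_fun [set: lattice_field R d] (swap_map k S).
Proof.
have mex l : measurable_fun [set: lattice_field R d] (fun x => 1 < `|x l|).
  apply: (measurable_fun_bool true); rewrite setTI.
  exact: measurable_exceed.
move=> mS; apply: measurable_fun_ifT => //.
  apply: measurable_and => //.
  by apply: (measurableT_comp (measurable_mem mS)); exact: measurable_shift.
apply: measurable_fun_ifT => //.
by apply: measurable_and => //; exact: measurable_mem.
Qed.

Lemma exceedance_map_swap_map k S :
  measurable S -> exceedance_map (@field0 R d) (swap_map k S).
Proof.
move=> mS; split; first exact: measurable_funTS (measurable_swap_map k mS).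
move=> x x0; rewrite /exceedances /swap_map /=.
by case: ifP => [/andP[]//|_]; case: ifP => [/andP[]|].
Qed.

Lemma bijective_on_swap_map k S :
  measurable S -> (forall x, S x -> ~ S (shift_field k x)) ->
  Defs.bijective_on (@field0 R d) (swap_map k S).
Proof.
move=> mS sepS; apply: bijective_on_involutive.
- exact: exceedance_domain_field0.
- exact: exceedance_map_swap_map.
move=> x x0; rewrite [in X in shift_field X]/swap_map [X in _ = - X]/swap_map.
case: ifPn => [/andP[xk /set_mem Sk]|N1].
  rewrite /swap_map ifF; last first.
    by apply/negbTE/negP => /andP[_ /set_mem]; exact: sepS.
  by rewrite /shift_field addNr x0 mem_set.
case: ifPn => [/andP[xk /set_mem Sk]|N2].
  by rewrite /swap_map shift_fieldNK /shift_field addrN x0 mem_set // opprK.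
by rewrite shift_field0 /swap_map (negbTE N1) (negbTE N2) oppr0.
Qed.

End swap.

Section exchange_of_stationarity.
Variables (R : realType) (d : nat) (Q : probability (lattice_field R d) R).
Hypothesis Q0 : Q (@field0 R d) = 1%E.
Hypothesis statQ : forall B tau,
  exceedance_domain B -> exceedance_map B tau -> Defs.bijective_on B tau ->
  Q B = 1%E -> forall A, measurable A ->
  Q (B `&` exceedance_shift tau @^-1` A) = Q A.

(** Apply stationarity under [swap_map] to the fields of A with an exceedance at
-k: only a field that has been moved by k can end up there. *)
Lemma exchange_separated k S A :
  measurable S -> (forall x, S x -> ~ S (shift_field k x)) ->
  measurable A -> A `<=` S -> departure Q k A = arrival Q k A.
Proof.
move=> mS sepS mA AS; rewrite departureE arrivalE.
pose A' : set (lattice_field R d) := [set x | 1 < `|x (- k)| /\ A x].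
rewrite -/A'.
have mA' : measurable A' by apply: measurableI => //; exact: measurable_exceed.
rewrite -(statQ (@exceedance_domain_field0 R d) (exceedance_map_swap_map k mS)
  (bijective_on_swap_map mS sepS) Q0 mA').
have [mf0 _ _] := @exceedance_domain_field0 R d.
have mD := measurable_gt1_preimage (measurable_coord k) (measurable_shift k) mA.
rewrite -(probability_full_setI mf0 Q0 mD); congr (Q _).
apply/seteqP; split=> x [x0].
  move=> [xk Ak]; split=> //; rewrite /A' /exceedance_shift /swap_map /=.
  by rewrite xk mem_set /=; [rewrite {1}/shift_field addNr|exact: AS].
rewrite /A' /exceedance_shift /swap_map /=.
case: ifPn => [/andP[xk _] [_ Ak]//|N1].
case: ifPn => [/andP[xk /set_mem Sx] [_ /AS Sk]|N2].
  by case: (sepS _ Sk); rewrite shift_fieldNK.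
rewrite shift_field0 => -[xk /AS Sx]; case/negP: N2.
by rewrite xk mem_set.
Qed.

(** The boolean is the direction in which the rational level q is crossed
between i - k and i. Shifting by k puts the value at i in the place of the one
at i - k, so that a field and its shift never lie in the same crossing set;
the remaining set collects the k-periodic fields. *)
Definition crossing k (z : option ('rV[int]_d * rat * bool)) :
    set (lattice_field R d) :=
  match z with
  | Some (i, q, b) =>
      [set x | ((x (i - k) < ratr q) = b) /\ ((x i < ratr q) = ~~ b)]
  | None => [set x | shift_field k x = x]
  end.

Lemma crossing_cover k : \bigcup_z crossing k z = [set: lattice_field R d].
Proof.
apply/seteqP; split=> // x _.
have [per|/existsNP[i]] := pselect (forall i, x (i - k) = x i).
  exists None => //; apply/funext => i.
  by rewrite /shift_field -per addrK.
move=> /eqP; rewrite neq_lt => /orP[] /rat_in_itvoo[q]; rewrite in_itv /=;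
  move=> /andP[q1 q2].
  by exists (Some (i, q, true)) => //=; rewrite q1 (lt_gtF q2).
by exists (Some (i, q, false)) => //=; rewrite q1 (lt_gtF q2).
Qed.

Lemma measurable_crossing k z : measurable (crossing k z).
Proof.
have mlt i (q : rat) (b : bool) :
    measurable [set x : lattice_field R d | (x i < ratr q) = b].
  have mf : measurable_fun [set: lattice_field R d] (fun x => x i < ratr q).
    by apply: measurable_fun_ltr => //; exact: measurable_coord.
  by have := measurable_preimage mf (I : measurable [set b]).
case: z => [[[i q] b]|]; first by apply: measurableI; exact: mlt.
rewrite (_ : crossing k None = \bigcap_n
    (if unpickle n is Some i then [set x | x (i + k) = x i] else setT)).
  apply: bigcapT_measurable => n; case: unpickle => // i.
  have mf : measurable_fun [set: lattice_field R d] (fun x => x (i + k) == x i).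
    by apply: measurable_fun_eqr; exact: measurable_coord.
  rewrite (_ : mkset _ = (fun x => x (i + k) == x i) @^-1` [set true]).
    exact: measurable_preimage.
  by apply/seteqP; split=> x /= /eqP.
apply/seteqP; split=> x /=.
  move=> per n _; case: unpickle => // i.
  exact: shift_field_fixed.
move=> per; apply/funext => i.
by have := per (pickle i) I; rewrite pickleK.
Qed.

Lemma exchange_of_stationarity : exchange_formula Q.
Proof.
move=> k A mA; rewrite -departureE -arrivalE.
pose F n := if unpickle n is Some z then crossing k z else set0.
have smeas : <<s @measurable _ (lattice_field R d) >> = measurable.
  by apply: smallest_id; exact: sigma_algebra_measurable.
apply: (@g_sigma_algebra_measure_unique_cover _ _ _ measurable _ F) => //.
- by move=> n; rewrite /F; case: unpickle => // z; exact: measurable_crossing.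
- rewrite -(crossing_cover k); apply/seteqP; split=> x [n].
    by rewrite /F; case: unpickle => // z _ ?; exists z.
  by exists (pickle n) => //; rewrite /F pickleK.
- move=> n C; rewrite smeas => mC; rewrite /F.
  case: unpickle => [[[[i q] b]|]|].
  + apply: (@exchange_separated k (crossing k (Some (i, q, b)))) => //.
    * exact: measurable_crossing.
    * move=> x [_ xi] []; rewrite {1}/shift_field subrK xi.
      by case: (b).
    * by apply: measurableI => //; exact: measurable_crossing.
  (* On k-periodic fields x_k = x_0 = x_(-k), so both events are the same. *)
  + rewrite departureE arrivalE; congr (Q _).
    have perE (x : lattice_field R d) : shift_field k x = x -> x k = x (- k).
      move=> /shift_field_fixed per.
      by rewrite -[in LHS](add0r k) per -(per (- k)) addNr.
    apply/seteqP; split=> x /=.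
      move=> [xk [/(can_inj (shift_fieldK k)) per Ax]].
      by rewrite -perE //; rewrite per in Ax.
    by move=> [xk [per Ax]]; rewrite perE // !per.
  + by rewrite !set0I !measure0.
- by rewrite smeas.
Qed.

End exchange_of_stationarity.

(** * Integrals of functions of independent variables *)

Section independence.
Context (d d1 d2 : measure_display) (T : measurableType d) (R : realType).
Context (P : probability T R) (T1 : measurableType d1) (T2 : measurableType d2).
Variables (X1 : {RV P >-> T1}) (X2 : {RV P >-> T2}).
Hypothesis indep : independent_RV P X1 X2.

Lemma measurable_pairRV : measurable_fun [set: T] (fun w => (X1 w, X2 w)).
Proof. by apply: measurable_fun_pair. Qed.

Definition joint_law : measure (T1 * T2)%type R.
Proof.
refine (pushforward P (fun w => (X1 w, X2 w))).
exact: measurable_pairRV.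
Defined.

(** The joint law is the product of the marginals, so Tonelli applies. *)
Lemma independent_integral (f : T1 * T2 -> \bar R) :
  measurable_fun [set: T1 * T2] f -> (forall z, (0 <= f z)%E) ->
  (\int[P]_w f (X1 w, X2 w)
   = \int[P]_w \int[distribution P X2]_y f (X1 w, y))%E.
Proof.
move=> mf f0.
transitivity (\int[joint_law]_z f z)%E.
  by rewrite ge0_integral_pushforward //; exact: measurable_pairRV.
transitivity (\int[(distribution P X1 \x distribution P X2)%E]_z f z)%E.
  apply: eq_measure_integral => A mA _; apply/esym.
  by apply: product_measure_unique => // B C mB mC; exact: indep.
rewrite fubini_tonelli1 // ge0_integral_distribution //.
  exact: measurable_fun_fubini_tonelli_F.
by move=> y; exact: integral_ge0.
Qed.

Lemma independent_integral_section (phi : T1 -> R) (D : set (T1 * T2)) :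
  measurable_fun [set: T1] phi -> (forall x, 0 <= phi x) -> measurable D ->
  (\int[P]_(w in [set w | D (X1 w, X2 w)]) (phi (X1 w))%:E
   = \int[P]_w ((phi (X1 w))%:E
                * distribution P X2 [set y | D (X1 w, y)]))%E.
Proof.
move=> mphi phi0 mD.
transitivity (\int[P]_w (phi (X1 w) * \1_D (X1 w, X2 w))%:E)%E.
  rewrite integral_mkcond; apply: eq_integral => w _.
  rewrite /patch indicE.
  have -> : (w \in [set w | D (X1 w, X2 w)]) = ((X1 w, X2 w) \in D).
    by apply/idP/idP => /set_mem ?; apply/mem_set.
  by case: (_ \in D); rewrite ?mulr1 ?mulr0.
have mphi1 : measurable_fun [set: T1 * T2] (fun z => phi z.1 * \1_D z).
  apply: measurable_funM; first exact: measurableT_comp.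
  exact: measurable_indic.
rewrite (@independent_integral (fun z => (phi z.1 * \1_D z)%:E)) /=.
- apply: eq_integral => w _.
  have mS : measurable [set y | D (X1 w, y)].
    by apply: (measurable_preimage _ mD); exact: pair1_measurable.
  under eq_integral do rewrite EFinM.
  have -> : distribution P X2 [set y | D (X1 w, y)]
      = (\int[distribution P X2]_y (\1_D (X1 w, y))%:E)%E.
    by rewrite -[X in distribution P X2 X = _]setIT -integral_indic.
  rewrite ge0_integralZl_EFin // => _.
  apply: measurableT_comp => //.
  by apply: (measurableT_comp (measurable_indic mD)); exact: pair1_measurable.
- exact/measurable_EFinP.
- by move=> z; rewrite lee_fin mulr_ge0.
Qed.

End independence.

(** * The Pareto law *)

Section pareto.
Context d (T : measurableType d) (R : realType) (P : probability T R).
Variables (Y : {RV P >-> R}) (alpha : R).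
Hypotheses (alpha_gt0 : 0 < alpha) (paretoY : pareto P alpha Y).
Local Notation mu := (distribution P Y).

Lemma pareto_gt1 : mu `]1, +oo[ = 1%E.
Proof. by have := paretoY (lexx 1); rewrite /ccdf powR1. Qed.

Lemma pareto_setI (A : set R) : measurable A -> mu (`]1, +oo[ `&` A) = mu A.
Proof. by move=> mA; apply: probability_full_setI => //; exact: pareto_gt1. Qed.

(** As Y > 1 almost surely, the absolute value disappears and the event is a
half-line starting at 1 or beyond, where the Pareto tail is explicit. *)
Lemma pareto_tail_exceed (c t : R) : 0 < c ->
  mu [set y | 1 < `|y * c| /\ t < y]
  = (Num.max 1 (Num.max c^-1 t) `^ - alpha)%:E.
Proof.
move=> c0; rewrite -pareto_setI; last first.
  rewrite (_ : [set _ | _] = [set y | 1 < `|y * c|] `&` `]t, +oo[).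
    apply: measurableI => //; apply: measurable_gt1.
    exact: mulrr_measurable.
  by apply/seteqP; split=> y /=; rewrite in_itv /= andbT.
rewrite (_ : _ `&` _ = `]Num.max 1 (Num.max c^-1 t), +oo[%classic).
  by apply: paretoY; rewrite le_max lexx.
have Vlt y : (1 < y * c) = (c^-1 < y) by rewrite -ltr_pdivrMr // div1r.
apply/seteqP; split=> y /=; rewrite !in_itv /= !andbT !gt_max.
  move=> [y1]; rewrite gtr0_norm ?mulr_gt0 ?(lt_trans ltr01 y1) //.
  by rewrite Vlt => -[-> ->]; rewrite y1.
move=> /and3P[y1 yc yt]; split=> //.
by rewrite gtr0_norm ?mulr_gt0 ?(lt_trans ltr01 y1) // Vlt.
Qed.

Lemma pareto_exceed (a : R) : a != 0 ->
  mu [set y | 1 < `|y * a|] = (Num.max 1 `|a|^-1 `^ - alpha)%:E.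
Proof.
move=> a0; have a0' : 0 < `|a| by rewrite normr_gt0.
have mY : measurable [set y | 1 < `|y * a|].
  by apply: measurable_gt1; exact: mulrr_measurable.
have -> : Num.max 1 `|a|^-1 = Num.max 1 (Num.max `|a|^-1 1).
  by rewrite [Num.max _ 1]maxC maxA maxxx.
rewrite -pareto_tail_exceed // -pareto_setI //; congr (mu _).
by apply/seteqP; split=> y /=; rewrite in_itv /= andbT !normrM normr_id => -[].
Qed.

Lemma pareto_scale_ray (c t : R) : 0 < c ->
  ((c `^ alpha)%:E * mu [set y | (1 < `|y / c| /\ t < y / c)%R]
   = mu [set y | (1 < `|y * c| /\ t < y)%R])%E.
Proof.
move=> c0; rewrite pareto_tail_exceed //.
under eq_set do rewrite ltr_pdivlMr //.
rewrite pareto_tail_exceed ?invr_gt0 // invrK -EFinM.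
have -> : Num.max 1 (Num.max c (t * c)) = c * Num.max 1 (Num.max c^-1 t).
  by rewrite !maxr_pMr ?ltW // mulr1 divff ?gt_eqF // [t * c]mulrC maxCA.
rewrite powRM ?ltW ?lt_max ?ltr01 // mulrA powRN divff ?mul1r //.
by rewrite gt_eqF // powR_gt0.
Qed.

(** The scaling property of the Pareto law, by uniqueness of measures from the
case of half-lines. At c = 0 both sides vanish, since 1/0 = 0 and
0^alpha = 0. *)
Lemma pareto_scale (c : R) (U : set R) : 0 <= c -> measurable U ->
  ((c `^ alpha)%:E * mu [set y | (1 < `|y / c|)%R /\ U (y / c)%R]
   = mu [set y | (1 < `|y * c|)%R /\ U y])%E.
Proof.
rewrite le_eqVlt => /predU1P[<- _|c0 mU].
  rewrite powR0 ?gt_eqF // mul0e.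
  rewrite (_ : [set _ | _] = set0) ?measure0 //.
  by apply/seteqP; split=> y //= []; rewrite mulr0 normr0 ltr10.
have mdivc : measurable_fun [set: R] (fun y => y / c).
  exact: mulrr_measurable.
have mmulc : measurable_fun [set: R] (fun y => y * c).
  exact: mulrr_measurable.
pose m1 := mscale (NngNum (powR_ge0 c alpha))
  (restricted_image mu (measurable_gt1 mdivc) mdivc).
pose m2 := mrestr mu (measurable_gt1 mmulc).
have m1E A : m1 A
    = ((c `^ alpha)%:E * mu [set y | (1 < `|y / c|)%R /\ A (y / c)%R])%E.
  by rewrite /m1 /mscale /= /pushforward /mrestr setIC.
have m2E A : m2 A = mu [set y | (1 < `|y * c|)%R /\ A y].
  by rewrite /m2 /mrestr setIC.
rewrite -m1E -m2E.
apply: (@measure_unique _ _ _ (@RGenOInfty.G R)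
  (fun n => `]- n%:R, +oo[%classic)) => //.
- exact: RGenOInfty.measurableE.
- move=> _ _ [s ->] [t ->]; exists (Num.max s t).
  by apply/seteqP; split=> y /=; rewrite !in_itv /= !andbT gt_max => /andP.
- by move=> n; exists (- n%:R).
- apply/seteqP; split=> // y _; exists (Num.bound `|y|) => //=.
  rewrite in_itv /= andbT ltrNl (le_lt_trans (ler_norm _)) // normrN.
  exact: archi_boundP.
- move=> _ [t ->]; rewrite [LHS]m1E [RHS]m2E.
  have rayE (x : R) : (`]t, +oo[%classic x) = (t < x).
    by rewrite /= in_itv /= andbT.
  under eq_set do rewrite rayE.
  under [in RHS]eq_set do rewrite rayE.
  exact: pareto_scale_ray.
- move=> n; rewrite [X in (X < _)%E]m1E; apply: lte_mul_pinfty => //.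
    by rewrite lee_fin powR_ge0.
  rewrite (le_lt_trans (probability_le1 _ _)) ?ltry //.
  apply: measurableI; first exact: measurable_gt1.
  by apply: (measurable_preimage mdivc).
Qed.

End pareto.

(** * Polar decomposition *)

Lemma measurable_pair_coord (R : realType) (d : nat) (i : 'rV[int]_d) :
  measurable_fun [set: lattice_field R d * R] (fun z => z.2 * z.1 i).
Proof.
apply: measurable_funM => //.
exact: (measurableT_comp (measurable_coord i)).
Qed.

Section unit_field.
Variables (R : realType) (d : nat).
Implicit Types (x : lattice_field R d).

(** The polar decomposition of a field: its modulus is its absolute value at the
origin and its angular part is [unit_field]. *)
Definition unit_field x : lattice_field R d := scale_field `|x 0|^-1 x.

Lemma unit_field_scale (c : R) x :
  0 < c -> unit_field (scale_field c x) = unit_field x.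
Proof.
move=> c0; apply/funext => i; rewrite /unit_field /scale_field.
by rewrite normrM gtr0_norm // invfM mulrACA mulVf ?mul1r // gt_eqF.
Qed.

Lemma unit_field_id x : `|x 0| = 1 -> unit_field x = x.
Proof.
move=> x0; apply/funext => i.
by rewrite /unit_field /scale_field x0 invr1 mul1r.
Qed.

Lemma unit_field_shift k x :
  unit_field (shift_field k x) = scale_field `|x k|^-1 (shift_field k x).
Proof. by rewrite /unit_field {1}/shift_field add0r. Qed.

(** The size of the field at k is read off the angular part of its shift; thus
the time change formula also covers functions that depend on it. *)
Lemma unit_field_shift_origin k x :
  `|x 0| = 1 -> `|unit_field (shift_field k x) (- k)| = `|x k|^-1.
Proof.
move=> x0; rewrite unit_field_shift /scale_field /shift_field addNr normrM x0.
by rewrite mulr1 ger0_norm.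
Qed.

Lemma measurable_scale_field d' (T : measurableType d') (f : T -> R)
    (g : T -> lattice_field R d) :
  measurable_fun [set: T] f -> measurable_fun [set: T] g ->
  measurable_fun [set: T] (fun w => scale_field (f w) (g w)).
Proof.
move=> mf mg; apply: measurable_fun_field => i; apply: measurable_funM => //.
exact: (measurableT_comp (measurable_coord i)).
Qed.

Lemma measurable_norm_coord (i : 'rV[int]_d) :
  measurable_fun [set: lattice_field R d] (fun x => `|x i|).
Proof. by apply: measurableT_comp => //; exact: measurable_coord. Qed.

Lemma measurable_unit_field :
  measurable_fun [set: lattice_field R d] unit_field.
Proof.
apply: measurable_scale_field => //; apply: measurable_invr_ge0 => //.
exact: measurable_norm_coord.
Qed.

End unit_field.

Definition time_change_formula d' (T : measurableType d') (R : realType)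
    (P : probability T R) (d : nat) (Theta : {RV P >-> lattice_field R d})
    (alpha : R) : Prop :=
  forall (h : lattice_field R d -> R) (k : 'rV[int]_d),
    measurable_fun [set: lattice_field R d] h -> (forall x, 0 <= h x) ->
    ('E_P[fun w => (h (scale_field `|Theta w k|^-1 (shift_field k (Theta w)))
                    * (Theta w k != 0)%:R)%R]
     = 'E_P[fun w => (h (Theta w) * `|Theta w (- k)| `^ alpha)%R])%E.

Arguments time_change_formula {d' T R} P {d} Theta alpha.

Section spectral.
Context d' (T : measurableType d') (R : realType) (P : probability T R).
Variables (d : nat) (Theta : {RV P >-> lattice_field R d}) (Y : {RV P >-> R}).
Variable alpha : R.
Hypotheses (Theta0 : {ae P, forall w, `|Theta w 0| = 1})
  (alpha_gt0 : 0 < alpha) (paretoY : pareto P alpha Y)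
  (indep : independent_RV P Theta Y).
Local Notation Q := (distribution P (scale_RV Y Theta)).
Local Notation mu := (distribution P Y).

Lemma pareto_ae_gt1 : {ae P, forall w, 1 < Y w}.
Proof.
have mS : measurable (Y @^-1` `]1, +oo[) by exact: measurable_funPTI.
have PS : P (Y @^-1` `]1, +oo[) = 1%E by exact: (pareto_gt1 paretoY).
exists (~` (Y @^-1` `]1, +oo[)); split.
- exact: measurableC.
- by rewrite probability_setC // PS subee.
- by apply: subsetC => w /=; rewrite in_itv /= andbT.
Qed.

Lemma scale_RV_field0 : {ae P, forall w, field0 (scale_RV Y Theta w)}.
Proof.
move: Theta0 pareto_ae_gt1; apply: filterS2 => w T0 Y1.
rewrite /field0 /scale_RV /scale_field /= normrM T0 mulr1.
by rewrite gtr0_norm // (lt_trans ltr01).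
Qed.

Lemma law_field0 : Q (@field0 R d) = 1%E.
Proof.
have mS : measurable (scale_RV Y Theta @^-1` @field0 R d).
  apply: measurable_preimage; last exact: measurable_exceed.
  exact: measurable_scale_RV.
have : P (~` (scale_RV Y Theta @^-1` @field0 R d)) = 0%E.
  by apply/negligibleP; [exact: measurableC|exact: scale_RV_field0].
rewrite probability_setC // => /eqP; rewrite sube_eq ?fin_num_measure //.
by rewrite add0e => /eqP/esym.
Qed.

Lemma ge0_integral_law (D : set (lattice_field R d))
    (g : lattice_field R d -> \bar R) :
  measurable D -> measurable_fun [set: lattice_field R d] g ->
  (forall x, (0 <= g x)%E) ->
  (\int[Q]_(x in D) g x
   = \int[P]_(w in scale_RV Y Theta @^-1` D) g (scale_RV Y Theta w))%E.
Proof.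
move=> mD mg g0; rewrite ge0_integral_pushforward //.
exact: measurable_funTS.
Qed.

(** Conditionally on Theta, only the radial variable Y is random. *)
Lemma law_sections (D : set (lattice_field R d * R)) :
  measurable D ->
  P [set w | D (Theta w, Y w)] = (\int[P]_w mu [set y | D (Theta w, y)])%E.
Proof.
move=> mD.
have mDw : measurable [set w | D (Theta w, Y w)].
  by apply: (measurable_preimage _ mD); exact: measurable_pairRV.
rewrite -[LHS]mul1e -(integral_cst P mDw).
rewrite [LHS](independent_integral_section indep (measurable_cst (1 : R))
  (fun=> ler01) mD).
by apply: eq_integral => w _; rewrite mul1e.
Qed.

Lemma measurable_unit_shift k :
  measurable_fun [set: T] (fun w => unit_field (shift_field k (Theta w))).
Proof.
apply: (measurableT_comp (@measurable_unit_field R d)).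
by apply: (measurableT_comp (measurable_shift k)).
Qed.

Lemma measurable_neq0 k :
  measurable_fun [set: T] (fun w => (Theta w k != 0)%:R : R).
Proof.
have mf : measurable_fun [set: T] (fun w => Theta w k == 0).
  apply: measurable_fun_eqr => //.
  exact: (measurableT_comp (measurable_coord k)).
rewrite (_ : (fun _ => _) = (fun w => if Theta w k == 0 then 0 else 1)).
  exact: measurable_fun_ifT.
by apply/funext => w; case: eqP.
Qed.

(** The time change formula applied to the conditional probability of the
exchange event, seen as a function of the angular part of the shifted field. *)
Lemma exchange_of_time_change :
  time_change_formula P Theta alpha -> exchange_formula Q.
Proof.
move=> tc k A mA.
(* With Theta_0 of modulus 1, dividing by |x_(-k)| at
   x = unit_field (phi_k Theta) multiplies by |Theta_k|, which undoes the
   normalization of phi_k Theta. *)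
pose N (x : lattice_field R d) := mu [set y | 1 < `|y / `|x (- k)| | /\
  A (scale_field (y / `|x (- k)|) x)].
pose f (z : lattice_field R d * R) : R := z.2 / `|z.1 (- k)|.
have mf : measurable_fun [set: lattice_field R d * R] f.
  apply: measurable_funM => //; apply: measurable_invr_ge0 => //.
  exact: (measurableT_comp (measurable_norm_coord (- k))).
have mD : measurable [set z | 1 < `|f z| /\ A (scale_field (f z) z.1)].
  by apply: measurable_gt1_preimage => //; exact: measurable_scale_field.
have mN : measurable_fun [set: lattice_field R d] N.
  exact: (measurable_section mu mD).
have Nfin x : N x \is a fin_num.
  rewrite fin_num_measure //.
  exact: (measurable_preimage (pair1_measurable x) mD).
pose h x := fine (N x).
have hE x : (h x)%:E = N x by rewrite /h fineK.
have mh : measurable_fun [set: lattice_field R d] h.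
  by apply/measurable_EFinP; rewrite (_ : _ \o _ = N) //; apply/funext => x /=.
have h0 x : 0 <= h x by rewrite -lee_fin hE.
have mscale : measurable_fun [set: lattice_field R d * R]
    (fun z => scale_field z.2 z.1) by exact: measurable_scale_field.
have mshift : measurable_fun [set: lattice_field R d * R]
    (fun z => shift_field k (scale_field z.2 z.1)).
  exact: (measurableT_comp (measurable_shift k)).
have mDk := measurable_gt1_preimage (measurable_pair_coord k) mshift mA.
have mDNk := measurable_gt1_preimage (measurable_pair_coord (- k)) mscale mA.
transitivity (\int[P]_w mu [set y | (1 < `|y * Theta w k|)%R /\
    A (shift_field k (scale_field y (Theta w)))])%E.
  exact: law_sections mDk.
transitivity (\int[P]_w mu [set y | (1 < `|y * Theta w (- k)|)%R /\
    A (scale_field y (Theta w))])%E; last first.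
  by apply/esym; exact: law_sections mDNk.
have := tc h k mh h0; rewrite unlock => tch.
transitivity (\int[P]_w (h (unit_field (shift_field k (Theta w)))
    * (Theta w k != 0)%:R)%:E)%E.
  apply: ge0_ae_eq_integral => //.
  - exact: (measurableT_comp (measurable_section mu mDk)).
  - apply/measurable_EFinP; apply: measurable_funM; last exact: measurable_neq0.
    by apply: (measurableT_comp mh); exact: measurable_unit_shift.
  - by move=> w _; rewrite lee_fin mulr_ge0.
  move: Theta0; apply: filterS => w T0 _.
  rewrite EFinM hE /N unit_field_shift_origin // invrK.
  have [Tk|Tk] := eqVneq (Theta w k) 0.
    rewrite mule0 (_ : [set _ | _] = set0) ?measure0 //.
    by apply/seteqP; split=> y //= []; rewrite Tk mulr0 normr0 ltr10.
  have nTk : `|Theta w k| != 0 by rewrite normr_eq0.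
  rewrite mule1; congr (mu _); apply/funext => y /=; congr (_ /\ A _).
    by rewrite !normrM normr_id.
  rewrite unit_field_shift; apply/funext => i; rewrite /scale_field mulrA.
  by rewrite mulfK.
under eq_integral do rewrite unit_field_shift.
rewrite tch; apply: eq_integral => w _.
rewrite EFinM hE muleC /N.
have nn (y a : R) : `|y * a| = `|y * `|a| | by rewrite !normrM normr_id.
under [in RHS]eq_set do rewrite nn.
apply: (pareto_scale alpha_gt0 paretoY
  (U := [set y | A (scale_field y (Theta w))])) => //.
apply: measurable_preimage => //.
exact: measurable_scale_field.
Qed.

(** The exchange formula sees the shifted angular part only on the event
|Y Theta_k| > 1, whose conditional probability min(1, |Theta_k|)^alpha has to
be divided out. *)
Lemma time_change_of_exchange :
  exchange_formula Q -> time_change_formula P Theta alpha.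
Proof.
move=> exQ h k mh h0; rewrite unlock.
(* Equals min(1, |Theta_k|)^(-alpha) at x = unit_field (phi_k Theta). *)
pose W (x : lattice_field R d) := Num.max 1 `|x (- k)| `^ alpha.
have mW : measurable_fun [set: lattice_field R d] W.
  apply: (measurableT_comp (measurable_powR _)).
  by apply: measurable_maxr => //; exact: measurable_norm_coord.
pose phi x := h x * W x.
have mphi : measurable_fun [set: lattice_field R d] phi.
  exact: measurable_funM.
have phi0 x : 0 <= phi x by rewrite mulr_ge0 ?powR_ge0.
pose g x := (phi (unit_field x))%:E.
have mg : measurable_fun [set: lattice_field R d] g.
  apply/measurable_EFinP; apply: measurableT_comp => //.
  exact: measurable_unit_field.
have g0 x : (0 <= g x)%E by rewrite lee_fin.
have mgk : measurable_fun [set: lattice_field R d] (g \o shift_field k).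
  by apply: measurableT_comp => //; exact: measurable_shift.
have mX : measurable_fun [set: T] (scale_RV Y Theta).
  exact: measurable_scale_RV.
pose E l : set T := [set w | 1 < `|Y w * Theta w l|].
have mE l : measurable (E l).
  exact: (measurable_preimage mX (measurable_exceed l)).
have mexceed l :
    measurable [set z : lattice_field R d * R | 1 < `|z.2 * z.1 l|].
  exact: (measurable_gt1 (measurable_pair_coord l)).
pose phik x := phi (unit_field (shift_field k x)).
have mphik : measurable_fun [set: lattice_field R d] phik.
  apply: (measurableT_comp mphi).
  apply: (measurableT_comp (@measurable_unit_field R d)).
  exact: measurable_shift.
have phik0 x : 0 <= phik x by exact: phi0.
have mPhi (f : lattice_field R d -> \bar R) l :
    measurable_fun [set: lattice_field R d] f ->
    measurable_fun (E l) (f \o scale_RV Y Theta).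
  by move=> mf; apply: measurable_funTS; exact: measurableT_comp.
have mTheta (f : lattice_field R d -> R) D :
    measurable_fun [set: lattice_field R d] f ->
    measurable_fun D (fun w => (f (Theta w))%:E).
  move=> mf; apply: measurable_funTS; apply/measurable_EFinP.
  exact: measurableT_comp.
transitivity (\int[P]_(w in E k) (phik (Theta w))%:E)%E.
  rewrite (independent_integral_section indep mphik phik0 (mexceed k)).
  apply: ge0_ae_eq_integral => //.
  - apply/measurable_EFinP; apply: measurable_funM; last exact: measurable_neq0.
    under eq_fun do rewrite -unit_field_shift.
    by apply: (measurableT_comp mh); exact: measurable_unit_shift.
  - apply: emeasurable_funM; first exact: mTheta.
    exact: (measurableT_comp (measurable_section mu (mexceed k))).
  - by move=> w _; rewrite lee_fin mulr_ge0.
  - by move=> w _; rewrite mule_ge0 ?lee_fin.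
  move: Theta0; apply: filterS => w T0 _; rewrite -unit_field_shift.
  have [Tk|Tk] := eqVneq (Theta w k) 0.
    rewrite mulr0 (_ : [set _ | _] = set0) ?measure0 ?mule0 //.
    by apply/seteqP; split=> y //=; rewrite Tk mulr0 normr0 ltr10.
  rewrite (pareto_exceed paretoY) // -EFinM mulr1 /phik /phi /W.
  by rewrite unit_field_shift_origin // -mulrA powRN divff ?mulr1.
transitivity (\int[P]_(w in E k) g (shift_field k (scale_RV Y Theta w)))%E.
  apply: ge0_ae_eq_integral => //; [exact: mTheta|exact: (mPhi _ _ mgk)|..].
    by move=> w _; rewrite lee_fin.
  move: pareto_ae_gt1; apply: filterS => w Y1 _.
  have Y0 : 0 < Y w := lt_trans ltr01 Y1.
  by rewrite /phik -(unit_field_scale _ Y0).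
transitivity (\int[P]_(w in E (- k)%R) g (scale_RV Y Theta w))%E.
  have := exchange_integral k exQ mg g0.
  by rewrite !ge0_integral_law //; exact: measurable_exceed.
transitivity (\int[P]_(w in E (- k)%R) (phi (Theta w))%:E)%E.
  apply: ge0_ae_eq_integral => //; [exact: (mPhi _ _ mg)|exact: mTheta|..].
    by move=> w _; rewrite lee_fin.
  move: Theta0 pareto_ae_gt1; apply: filterS2 => w T0 Y1 _.
  by rewrite /g /scale_RV unit_field_scale ?unit_field_id // (lt_trans ltr01).
rewrite (independent_integral_section indep mphi phi0 (mexceed (- k))).
apply: eq_integral => w _ /=.
have [T0|T0] := eqVneq (Theta w (- k)) 0.
  rewrite T0 normr0 powR0 ?gt_eqF // mulr0 (_ : [set _ | _] = set0).
    by rewrite measure0 mule0.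
  by apply/seteqP; split=> y //=; rewrite mulr0 normr0 ltr10.
rewrite (pareto_exceed paretoY) // -EFinM -mulrA; congr (_ * _)%:E.
have c0 : 0 < `|Theta w (- k)| by rewrite normr_gt0.
(* W(Theta) min(1, c)^alpha = c^alpha for c = |Theta_(-k)|. *)
have Wc : Num.max 1 `|Theta w (- k)|
    = `|Theta w (- k)| * Num.max 1 `|Theta w (- k)|^-1.
  by rewrite maxr_pMr ?ltW // mulr1 divff ?gt_eqF // maxC.
by rewrite /W Wc powRM ?ltW ?lt_max ?ltr01 // powRN -mulrA divff ?mulr1.
Qed.

End spectral.

Theorem proposition2p10 (R : realType) (d : nat)
    (disp : measure_display) (T : measurableType disp) (P : probability T R)
    (Theta : {RV P >-> lattice_field R d}) (Y : {RV P >-> R}) (alpha : R)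
    (Theta0 : {ae P, forall w, `|Theta w 0| = 1})
    (alpha_gt0 : 0 < alpha) (paretoY : pareto P alpha Y)
    (indep : independent_RV P Theta Y) :
  (forall (h : lattice_field R d -> R) (k : 'rV[int]_d),
      measurable_fun [set: lattice_field R d] h -> (forall x, 0 <= h x) ->
      ('E_P[fun w => (h (scale_field `|Theta w k|^-1 (shift_field k (Theta w)))
                      * (Theta w k != 0)%:R)%R]
       = 'E_P[fun w => (h (Theta w) * `|Theta w (- k)| `^ alpha)%R])%E)
  <-> exceedance_stationary P (scale_RV Y Theta).
Proof.
split=> [time_change|[_ stationary]].
  split; first exact: scale_RV_field0 Theta0 paretoY.
  move=> B tau [domB mapB bijB B1] A mA.
  apply: stationary_of_exchange => //.
  by apply: (exchange_of_time_change Theta0 alpha_gt0 paretoY indep).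
apply: (time_change_of_exchange Theta0 alpha_gt0 paretoY indep).
apply: exchange_of_stationarity; first exact: law_field0 Theta0 paretoY.
by move=> B tau domB mapB bijB B1 A mA; exact: stationary.
Qed.
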